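(* Let $A=(a_{i,j})\in\mathrm{Mat}(n,\mathbb{R})$ be a real X-matrix, and set $d_i=a_{i,i}$ and $e_i=a_{i,n-i+1}$ for all $i\in\{1,\dots,n\}$ with $i\neq n-i+1$. Then every eigenvalue $\lambda\in\mathbb{C}$ of $A$ lies on the boundary of one of the associated Cassini ovals, i.e. $$\lambda\in\partial C\bigl(d_i,\,d_{n-i+1},\,|e_i e_{n-i+1}|\bigr)\quad\text{for some } i\in\{1,\dots,\lfloor n/2\rfloor\},$$ or else $n$ is odd and $\lambda$ is the central entry $a_{\frac{n+1}{2},\frac{n+1}{2}}$.
   Context: $\mathrm{Mat}(n,\mathbb{R})$ is the ring of $n\times n$ real matrices. A matrix $A=(a_{i,j})\in\mathrm{Mat}(n,\mathbb{R})$ is an X-matrix if $a_{i,j}=0$ whenever $i\neq j$ and $i+j\neq n+1$. For $z_1,z_2\in\mathbb{C}$ and a real number $d\ge 0$, the Cassini oval is $C(z_1,z_2,d)=\{s\in\mathbb{C} : |s-z_1|\,|s-z_2|\le d\}$, and $\partial$ denotes the topological boundary in $\mathbb{C}$. *)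

(* Defs.v *)
From HB Require Import structures.
From mathcomp Require Import all_boot all_order all_algebra.
From mathcomp Require Import all_classical all_reals topology normedtype.
From mathcomp Require Import complex.

Set Implicit Arguments.
Unset Strict Implicit.
Unset Printing Implicit Defensive.

Import Order.TTheory GRing.Theory Num.Theory.
Import numFieldNormedType.Exports.

Local Open Scope ring_scope.
Local Open Scope classical_set_scope.
Local Open Scope complex_scope.

(* Indices are 0-based: i : 'I_n is the mathematical index i.+1. In particular
   rev_ord i is the mathematical index n - i.+1 + 1. *)
Definition is_X_matrix (R : realType) (n : nat) (A : 'M[R]_n) : Prop :=
  forall i j : 'I_n, i != j -> (i.+1 + j.+1)%N != n.+1 -> A i j = 0.

Definition boundary (T : topologicalType) (S : set T) : set T :=
  closure S `\` interior S.

(* R[i]^o is R[i] with the topology of its modulus. The norm of R[i] takes its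
   values in R[i], where x <= y means Im x = Im y and Re x <= Re y; between
   moduli and real constants this is the order of R. *)
Definition cassini_oval (R : realType) (z1 z2 : R[i]) (d : R) : set R[i]^o :=
  [set s : R[i]^o | `|(s : R[i]) - z1| * `|(s : R[i]) - z2| <= d%:C].

(* Main.v *)
Require Import Defs.
From HB Require Import structures.
From mathcomp Require Import all_boot all_order all_algebra.
From mathcomp Require Import all_classical all_reals topology normedtype.
From mathcomp Require Import complex.
From mathcomp Require Import zify ring.

(** Since [A] is an X-matrix, the eigenvector equation [v *m A = lambda *: v]
    couples the coordinate [j] of [v] with the coordinate [rev_ord j] only.
    At a [j] with [v 0 j != 0] there are two possibilities. If [j] is the
    central index, the equation reads [lambda * v_j = a_jj * v_j]. Otherwise
    the equations at [j] and [rev_ord j] say that [lambda] is an eigenvalue of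
    a 2 x 2 block, so that
      [(lambda - d_j) * (lambda - d_(rev_ord j)) = e_j * e_(rev_ord j)]
    ([X_eigenvector_block]); taking moduli, [lambda] lies on the level curve
    that bounds the oval of [j], which is also that of [rev_ord j].

    It remains to see that a point [s] of the level curve is a boundary point
    of the oval. It belongs to the oval, so the claim is that it is not
    interior, which is the maximum modulus principle for
    [p s = (s - z1) * (s - z2)]. For this monic quadratic an elementary
    argument suffices ([quadratic_modulus_increases]): averaging [p] over
    [s + h] and [s - h] cancels the linear term, and the remaining [h ^+ 2] can
    be made to point in the direction of [p s], for arbitrarily small [h]. *)

Set Implicit Arguments.
Unset Strict Implicit.
Unset Printing Implicit Defensive.

Import Order.TTheory GRing.Theory Num.Theory.
Import numFieldNormedType.Exports.

Local Open Scope ring_scope.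
Local Open Scope classical_set_scope.
Local Open Scope complex_scope.

(** * Modulus of a monic quadratic *)

(** A square root of the phase of [c]; at [c = 0] every unit vector works. *)
Lemma unit_sqrt_phase (C : numClosedFieldType) (c : C) :
  exists2 w : C, `|w| = 1 & w ^+ 2 * `|c| = c.
Proof.
have [->|c0] := eqVneq c 0; first by exists 1; rewrite ?normr1 // normr0 mulr0.
exists (sqrtC (c / `|c|)); last by rewrite sqrtCK divfK // normr_eq0.
apply/eqP; rewrite -sqrp_eq1 // -normrX sqrtCK.
by rewrite normrM normfV normr_id divff // normr_eq0.
Qed.

(** With [w] a square root of the phase of [p s = (s - z1) * (s - z2)] and
    [h = w * t], the mean of [p (s + h)] and [p (s - h)] is [p s + h ^+ 2],
    of modulus [`|p s| + t ^+ 2]. By the triangle inequality the moduli of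
    these two values cannot both be at most [`|p s|]. *)
Lemma quadratic_modulus_increases (C : numClosedFieldType) (z1 z2 s t : C) :
  0 < t -> exists2 h : C, `|h| = t &
    `|s - z1| * `|s - z2| < `|s + h - z1| * `|s + h - z2|.
Proof.
move=> t_gt0; rewrite -normrM.
have [w w1 wc] := unit_sqrt_phase ((s - z1) * (s - z2)).
have norm_wt : `|w * t| = t by rewrite normrM w1 mul1r gtr0_norm.
have mean : (s + w * t - z1) * (s + w * t - z2)
    + (s - w * t - z1) * (s - w * t - z2)
  = w ^+ 2 * ((`|(s - z1) * (s - z2)| + t ^+ 2) *+ 2).
  by rewrite mulrnAr (mulrDr (w ^+ 2)) wc; ring.
have ger0_norm_mean := ger0_norm
  (addr_ge0 (normr_ge0 ((s - z1) * (s - z2))) (exprn_ge0 2 (ltW t_gt0))).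
have := ler_normD ((s + w * t - z1) * (s + w * t - z2))
                  ((s - w * t - z1) * (s - w * t - z2)).
rewrite mean (normrM (w ^+ 2)) normrX w1 expr1n mul1r normrMn ger0_norm_mean => le_sum.
have [lt_p|le_p] := real_ltP (normr_real ((s - z1) * (s - z2)))
                             (normr_real ((s + w * t - z1) * (s + w * t - z2))).
  by exists (w * t); rewrite // -normrM.
exists (- (w * t)); first by rewrite normrN.
rewrite -normrM real_ltNge ?normr_real //; apply/negP => le_m.
have := le_trans le_sum (lerD le_p le_m).
by rewrite -mulr2n lerMn2r /= gerDl lt_geF ?exprn_gt0.
Qed.

(** A ball around [s] inside the oval would contradict
    [quadratic_modulus_increases], even when [s] is a double point of the level
    curve, or when [d = 0] and the oval consists of the two foci. *)
Lemma level_curve_boundary_cassini (R : realType) (z1 z2 s : R[i]) (d : R) :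
  `|s - z1| * `|s - z2| = d%:C -> boundary (cassini_oval z1 z2 d) s.
Proof.
move=> sd; split; first by apply: subset_closure; rewrite /cassini_oval /= sd.
move=> /nbhs_ballP[r /= r_gt0 sub_oval].
have [h norm_h] := quadratic_modulus_increases z1 z2 s (divr_gt0 r_gt0 (ltr0n _ 2)).
rewrite sd => /lt_geF /negP; apply; apply: (sub_oval (s + h)).
rewrite -ball_normE /= opprD addNKr normrN norm_h.
by rewrite ltr_pdivrMr ?ltr0n // ltr_pMr // ltr1n.
Qed.

(** * Eigenvectors of X-matrices *)

Lemma X_matrix_entry0 (R : realType) (n : nat) (A : 'M[R]_n) (i j : 'I_n) :
  is_X_matrix A -> i != j -> i != rev_ord j -> A i j = 0.
Proof.
move=> hA ij irj; apply: hA => //; apply: contra irj => /eqP ij_n.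
by apply/eqP/val_inj => /=; lia.
Qed.

Lemma X_mulmx_central (R : realType) (n : nat) (A : 'M[R]_n)
    (u : 'rV[R[i]]_n) (j : 'I_n) :
  is_X_matrix A -> rev_ord j = j ->
  (u *m map_mx (real_complex R) A) 0 j = u 0 j * (A j j)%:C.
Proof.
move=> hA rj; rewrite mxE (bigD1 j) //= big1 ?addr0 ?mxE // => i ij.
by rewrite mxE (X_matrix_entry0 hA) ?rj // mulr0.
Qed.

Lemma X_mulmx_pair (R : realType) (n : nat) (A : 'M[R]_n)
    (u : 'rV[R[i]]_n) (j : 'I_n) :
  is_X_matrix A -> rev_ord j != j ->
  (u *m map_mx (real_complex R) A) 0 j =
    u 0 j * (A j j)%:C + u 0 (rev_ord j) * (A (rev_ord j) j)%:C.
Proof.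
move=> hA rj; rewrite mxE (bigD1 j) //= (bigD1 (rev_ord j)) //= big1.
  by rewrite addr0 !mxE.
by move=> i /andP[ij irj]; rewrite mxE (X_matrix_entry0 hA) // mulr0.
Qed.

(** The characteristic equation of the block with indices [j] and [rev_ord j],
    obtained by eliminating [u 0 (rev_ord j)] from the two equations. *)
Lemma X_eigenvector_block (R : realType) (n : nat) (A : 'M[R]_n)
    (u : 'rV[R[i]]_n) (j : 'I_n) (lambda : R[i]) :
  is_X_matrix A -> rev_ord j != j -> u 0 j != 0 ->
  u *m map_mx (real_complex R) A = lambda *: u ->
  (lambda - (A j j)%:C) * (lambda - (A (rev_ord j) (rev_ord j))%:C) =
    (A j (rev_ord j) * A (rev_ord j) j)%:C.
Proof.
move=> hA rj uj0 eig.
have := X_mulmx_pair u hA rj; rewrite eig mxE => eq_j.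
have /(X_mulmx_pair u hA) : rev_ord (rev_ord j) != rev_ord j by rewrite rev_ordK eq_sym.
rewrite eig mxE rev_ordK => eq_rj.
apply: (mulIf uj0); rewrite rmorphM /=.
have eq_j' : (lambda - (A j j)%:C) * u 0 j
    = u 0 (rev_ord j) * (A (rev_ord j) j)%:C.
  by rewrite mulrBl eq_j; ring.
have eq_rj' : (lambda - (A (rev_ord j) (rev_ord j))%:C) * u 0 (rev_ord j)
    = u 0 j * (A j (rev_ord j))%:C.
  by rewrite mulrBl eq_rj; ring.
by rewrite mulrAC eq_j' mulrAC [u 0 _ * _]mulrC eq_rj'; ring.
Qed.

(** * Location of the eigenvalues *)

Theorem theorem26 (R : realType) (n : nat) (A : 'M[R]_n)
    (hA : is_X_matrix A) (lambda : R[i])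
    (hlambda : eigenvalue (map_mx (real_complex R) A) lambda) :
  let d := fun i : 'I_n => A i i in
  let e := fun i : 'I_n => A i (rev_ord i) in
  (exists2 i : 'I_n, (i.+1 <= n./2)%N &
     boundary (cassini_oval (d i)%:C (d (rev_ord i))%:C
                            `|e i * e (rev_ord i)|) lambda)
  \/ (odd n /\
      exists2 i : 'I_n, i.+1 = (n.+1)./2 & lambda = (A i i)%:C).
Proof.
move=> d e; case/eigenvalueP: hlambda => v eig v_neq0.
have /rV0Pn[j vj0] := v_neq0.
have [rj|rj] := eqVneq (rev_ord j) j.
  have /= jn : (n - j.+1 = j)%N := congr1 val rj.
  have jlt := ltn_ord j.
  right; split; first by lia.
  exists j; first by lia.
  apply: (mulIf vj0); rewrite [RHS]mulrC -(X_mulmx_central v hA rj).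
  by rewrite eig mxE.
have block := X_eigenvector_block hA rj vj0 eig.
have on_curve : `|lambda - (d j)%:C| * `|lambda - (d (rev_ord j))%:C|
    = (`|e j * e (rev_ord j)|)%:C.
  by rewrite -normrM block /e rev_ordK normc_def /= expr0n /= addr0 sqrtr_sqr.
have jlt := ltn_ord j.
have rj_val : (n - j.+1 != j)%N by [].
left; have [jn|jn] := leqP j.+1 n./2.
  by exists j => //; apply: level_curve_boundary_cassini.
(* The ovals of [j] and [rev_ord j] coincide, and one of these two indices lies
   in the first half. *)
exists (rev_ord j); first by rewrite /=; lia.
apply: level_curve_boundary_cassini.
by rewrite rev_ordK mulrC on_curve [in RHS]mulrC.
Qed.
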